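(* Let $A$ be a finite alphabet with $|A| \ge 3$, let $n$ be a positive integer, and let $w$ be a nontrivial universal partial word for $A^n$. Then $w$ is cyclic: $|w| \ge 2(n-1)$ and the first $n-1$ characters of $w$ are equal, as a string over $A\cup\{\diamond\}$, to the last $n-1$ characters of $w$, with these two strings not overlapping in $w$.
   Context: A partial word over $A$ is a finite sequence of characters from $A \cup \{\diamond\}$, where $\diamond \notin A$ is a wild-card symbol; a word over $A$ contains no $\diamond$. $A^n$ denotes the set of words of length $n$ over $A$. For $x = x_1\cdots x_n \in A^n$ and a partial word $w = w_1\cdots w_N$, the position $i$ ($0 \le i \le N-n$) covers $x$ if $x_j = w_{i+j}$ for every $1\le j\le n$ with $w_{i+j}\in A$. A universal partial word for $A^n$ is a partial word $w$ such that every word in $A^n$ is covered by exactly one position of $w$. A universal partial word is trivial if it equals $\diamond^n$ (all characters are $\diamond$) or contains no $\diamond$ at all; otherwise it is nontrivial. *)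

(* Defs.v *)
From mathcomp Require Import all_boot.

Set Implicit Arguments.
Unset Strict Implicit.
Unset Printing Implicit Defensive.

(* [None] is the wild-card symbol and [Some a] is the letter [a]. *)
Definition pword (A : Type) := seq (option A).

(* [n <= size w] and [i <= size w - n] is written [i + n <= size w], which
   avoids truncated subtraction. Characters are indexed from 0. *)
Definition covers (A : Type) (n : nat) (w : pword A) (i : nat)
    (x : n.-tuple A) : Prop :=
  i + n <= size w /\
  forall (j : 'I_n) (a : A), nth None w (i + j) = Some a -> tnth x j = a.

Definition universal_pword (A : Type) (n : nat) (w : pword A) : Prop :=
  forall x : n.-tuple A, exists! i : nat, covers w i x.

Definition trivial_pword (A : eqType) (n : nat) (w : pword A) : Prop :=
  w = nseq n None \/ None \notin w.

(* The inequality says that the prefix and the suffix of length [n - 1] do not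
   overlap. *)
Definition cyclic_pword (A : Type) (n : nat) (w : pword A) : Prop :=
  2 * (n - 1) <= size w /\
  take (n - 1) w = drop (size w - (n - 1)) w.

(* Main.v *)
Require Import Defs.
From mathcomp Require Import all_boot.
From mathcomp Require Import zify.

(** Write [n = q.+1] and let the windows of length [n] start at [0, ..., m].
    Counting the words [u b] and the words [b u] ([b] a letter) for a fixed word
    [u] of length [q], and giving a character the weight [#|A|] if it is a
    wild-card and [1] otherwise, shows that the characters following the
    occurrences of [u], and also those preceding them, have total weight [#|A|].
    When [#|A| >= 3] this forces the two neighbours of every inner window of
    length [q] to be both wild-cards or both letters.  Subtracting the two
    counts then leaves only the first and the last windows of length [q], which
    must match the same words [u] and hence be equal.

    So [w] has period [m.+1] and its wild-cards also have period [n].  If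
    [m.+1 < n], the wild-cards have period [n - m.+1], so each window of length
    [n] contains two equal letters at distance [m.+1]; a word alternating at
    distance [m.+1] is then not covered. *)

Set Implicit Arguments.
Unset Strict Implicit.
Unset Printing Implicit Defensive.

(** * Windows and the words they match *)

Section Windows.

Variables (A : finType) (w : pword A).

Definition compat (o : option A) (b : A) : bool :=
  if o is Some a then b == a else true.

Definition weight (o : option A) : nat := if o is Some _ then 1 else #|A|.

(** A word is a function on [nat] of which only the values below [l] are read, so extending or
    shifting it needs no casts between tuple types. *)
Definition matches (l i : nat) (x : nat -> A) : bool :=
  [forall j : 'I_l, compat (nth None w (i + j)) (x j)].

Lemma matchesP l i x :
  reflect (forall j, j < l -> compat (nth None w (i + j)) (x j))
          (matches l i x).
Proof.
apply: (iffP forallP) => [H j jl|H j]; first exact: (H (Ordinal jl)).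
exact: H.
Qed.

Lemma sum_compat (o : option A) : \sum_(b : A) compat o b = weight o.
Proof.
case: o => [a|] /=; last by rewrite sum1_card.
by rewrite (bigD1 a) //= eqxx big1 // => b /negbTE ->.
Qed.

Lemma matches_recr q i x :
  matches q.+1 i x = matches q i x && compat (nth None w (i + q)) (x q).
Proof.
apply/matchesP/andP => [H|[/matchesP H Hq] j].
  by split; [apply/matchesP => j jq; apply: H; lia|apply: H].
rewrite ltnS leq_eqVlt => /orP[/eqP -> //|]; exact: H.
Qed.

Lemma matches_recl q i x :
  matches q.+1 i x =
  compat (nth None w i) (x 0) && matches q i.+1 (fun j => x j.+1).
Proof.
apply/matchesP/andP => [H|[H0 /matchesP H] [|j] jq].
- split; first by rewrite -[i in nth _ _ i]addn0; apply: H.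
  by apply/matchesP => j jq; rewrite addSnnS; apply: H.
- by rewrite addn0.
- by rewrite -addSnnS; apply: H.
Qed.

Lemma eq_matches l i x y :
  (forall j, j < l -> x j = y j) -> matches l i x = matches l i y.
Proof. by move=> E; apply: eq_forallb => j; rewrite E. Qed.

Lemma matches_odflt l i (d : A) :
  matches l i (fun j => odflt d (nth None w (i + j))).
Proof. by apply/matchesP => j _; case: nth => /=. Qed.

(** Fill the wild-cards of window [i] with [d]. The resulting word also matches window [k], so it
    carries [a] at [j]; as [d != a], this [a] is not a filling. *)
Lemma matches_sub_letter l i k (d a : A) j :
    (forall x, matches l i x -> matches l k x) -> d != a -> j < l ->
  nth None w (k + j) = Some a -> nth None w (i + j) = Some a.
Proof.
move=> sub da jl E; move: (sub _ (matches_odflt l i d)).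
move=> /matchesP/(_ j jl); rewrite E /=.
by case: nth => [b|] /= /eqP H; [rewrite H|rewrite H eqxx in da].
Qed.

End Windows.

(** Since [cr i = a] exhausts the first sum, [i] is the only index in [s]. The second sum becomes
    [cl i + e2 = a], and [cl i = 1] would need [e2 = a - 1], which is none of [0], [1], [a] when
    [a >= 3]. *)
Lemma weight_neighbour (I : finType) (s : pred I) (cr cl : I -> nat)
    (a e1 e2 : nat) (i : I) :
    3 <= a -> e2 \in [:: 0; 1; a] ->
    (forall k, 0 < cr k) -> (forall k, cl k \in [:: 1; a]) ->
    \sum_k s k * cr k + e1 = a -> \sum_k s k * cl k + e2 = a ->
    s i -> cr i = a ->
  cl i = a.
Proof.
move=> a3 he2 cr0 hcl Er El si cri.
have s0 k : k != i -> s k = false.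
  move=> ki; apply/negbTE/negP => sk.
  move: Er; rewrite (bigD1 i) //= (bigD1 k) //= si sk cri.
  by have := cr0 k; lia.
move: El; rewrite (bigD1 i) //= si big1 => [|k /s0 -> //].
rewrite mul1n addn0; move: (hcl i) he2; rewrite !inE.
by move=> /orP[]/eqP-> // /or3P[]/eqP->; lia.
Qed.

Section Universal.

Variables (A : finType) (w : pword A) (q m : nat).
Hypothesis cardA : 3 <= #|A|.
Hypothesis w_univ : universal_pword q.+1 w.
Hypothesis size_w : size w = m + q.+1.

Local Notation ch i := (nth None w i).

(** * Counting covered words by weights *)

Lemma weight_gt0 (o : option A) : 0 < weight o.
Proof. by case: o => //; exact: leq_trans cardA. Qed.

Lemma weight_mem (o : option A) : weight o \in [:: 1; #|A|].
Proof. by case: o => [b|]; rewrite !inE eqxx ?orbT. Qed.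

Lemma weight_eq_card (o : option A) : (weight o == #|A|) = (o == None).
Proof.
case: o => [b|]; rewrite ?eqxx //; apply/eqP => E.
by move: cardA; rewrite -E.
Qed.

Lemma covers_matches i (x : nat -> A) :
  covers w i [tuple x j | j < q.+1] <-> i <= m /\ matches w q.+1 i x.
Proof.
rewrite /covers size_w leq_add2r; split=> -[im H]; split=> //.
  by apply/forallP => j; case E: nth => [a|] //=; rewrite -(H _ _ E) tnth_mktuple.
by move=> j a E; move/forallP/(_ j): H; rewrite E tnth_mktuple => /eqP.
Qed.

Lemma matches_exists (x : nat -> A) : exists2 i, i <= m & matches w q.+1 i x.
Proof.
have [i [/covers_matches[im xi] _]] := w_univ [tuple x j | j < q.+1].
by exists i.
Qed.

Lemma matches_unique (x : nat -> A) i k :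
  i <= m -> matches w q.+1 i x -> k <= m -> matches w q.+1 k x -> i = k.
Proof.
move=> im xi km xk; have [l [_ lU]] := w_univ [tuple x j | j < q.+1].
by apply: etrans (lU k _); [apply/esym/lU|]; apply/covers_matches.
Qed.

Lemma sum_matches (x : nat -> A) : \sum_(i < m.+1) matches w q.+1 i x = 1.
Proof.
have [i im xi] := matches_exists x.
rewrite (bigD1 (Ordinal (im : i < m.+1))) //= xi big1 // => k /eqP ki.
apply/eqP; rewrite eqb0; apply/negP => xk; apply: ki; apply: val_inj => /=.
by apply: matches_unique xk im xi; rewrite -ltnS.
Qed.

Lemma sum_weight_right (u : nat -> A) :
  \sum_(i < m.+1) matches w q i u * weight (ch (i + q)) = #|A|.
Proof.
pose x b j := if j == q then b else u j.
(* Each word [u b] is covered once: write [#|A|] as a sum of ones over [b], then swap the sums. *)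
rewrite -sum1_card -(eq_bigr _ (fun b _ => sum_matches (x b))) exchange_big /=.
apply: eq_bigr => i _; rewrite -sum_compat big_distrr /=.
apply: eq_bigr => b _; rewrite matches_recr /x eqxx mulnb.
congr (nat_of_bool (_ && _)); apply: eq_matches => j jq.
by rewrite ltn_eqF.
Qed.

Lemma sum_weight_left (u : nat -> A) :
  \sum_(i < m.+1) matches w q i.+1 u * weight (ch i) = #|A|.
Proof.
pose x b j := if j is k.+1 then u k else b.
rewrite -sum1_card -(eq_bigr _ (fun b _ => sum_matches (x b))) exchange_big /=.
apply: eq_bigr => i _; rewrite -sum_compat big_distrr /=.
by apply: eq_bigr => b _; rewrite matches_recl mulnb andbC.
Qed.

Lemma inner_neighbours i : i < m -> (ch i == None) = (ch (i + q.+1) == None).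
Proof.
move=> im; have /card_gt0P[d _] : 0 < #|A| by lia.
pose u j := odflt d (ch (i.+1 + j)).
have ui : matches w q i.+1 u by exact: matches_odflt.
(* Windows [1] to [m] occur in both counts; window [0] occurs only in the first and window [m.+1]
   only in the second. These two terms become [e1] and [e2], in either order. *)
have := sum_weight_right u; rewrite big_ord_recl /= addnC => Er.
have := sum_weight_left u; rewrite big_ord_recr /= => El.
have mem3 (b : bool) (o : option A) : b * weight o \in [:: 0; 1; #|A|].
  case: b; first by rewrite mul1n in_cons weight_mem orbT.
  by rewrite mul0n in_cons eqxx.
pose k := Ordinal im.
rewrite -!weight_eq_card; apply/eqP/eqP => E.
  rewrite -addSnnS.
  apply: (weight_neighbour (i := k) cardA _ _ _ El Er ui E) => *;
    by rewrite ?weight_gt0 ?weight_mem.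
apply: (weight_neighbour (i := k) cardA _ _ _ Er El ui) => [|*|*|] /=;
  by rewrite ?weight_gt0 ?weight_mem // /bump add1n addSnnS.
Qed.

(** * The first and last windows of length [q] *)

Lemma border_balance (u : nat -> A) :
  matches w q 0 u * weight (ch q) = matches w q m.+1 u * weight (ch m).
Proof.
have := sum_weight_right u; rewrite big_ord_recl /= => Er.
have := sum_weight_left u; rewrite big_ord_recr /= => El.
apply: (@addIn (\sum_(i < m) matches w q i.+1 u * weight (ch i))).
rewrite [RHS]addnC El -{}Er; congr (_ + _).
apply: eq_bigr => i _; congr (_ * _); rewrite /bump add1n addSnnS.
have := inner_neighbours (ltn_ord i).
by case: (ch i) (ch (i + q.+1)) => [?|] [?|].
Qed.

Lemma border_matches (u : nat -> A) : matches w q 0 u = matches w q m.+1 u.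
Proof.
have := border_balance u; have := weight_gt0 (ch q); have := weight_gt0 (ch m).
by case: (matches w q 0 u); case: (matches w q m.+1 u); lia.
Qed.

Lemma border_neighbours : (ch m == None) = (ch q == None).
Proof.
have /card_gt0P[d _] : 0 < #|A| by lia.
have := border_balance (fun j => odflt d (ch (0 + j))).
rewrite -border_matches matches_odflt !mul1n => E.
by rewrite -!weight_eq_card E.
Qed.

Lemma exists_neq (a : A) : exists d, d != a.
Proof.
have /card_gt1P[x [y [_ _ xy]]] : 1 < #|A| by lia.
by have [xa|xa] := eqVneq x a; [exists y; rewrite -xa eq_sym|exists x].
Qed.

Lemma border_eq j : j < q -> ch j = ch (m.+1 + j).
Proof.
move=> jq; case E : (ch j) => [a|].
  have [d da] := exists_neq a.
  apply/esym/(matches_sub_letter (k := 0) _ da jq E) => x.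
  by rewrite border_matches.
case F : (ch (m.+1 + j)) => [a|] //; have [d da] := exists_neq a.
rewrite -E; apply: (matches_sub_letter (i := 0) _ da jq F) => x.
by rewrite border_matches.
Qed.

(** * Excluding an overlap of the borders *)

Lemma wildcard_period g k : g + m.+1 = q.+1 -> k + g < size w ->
  (ch k == None) = (ch (k + g) == None).
Proof.
(* The shift by [g] is a shift by [q.+1] combined with one back by [m.+1]; the latter comes last if
   [k < m] and first if [k > m]. At [k = m] neither order is available, and [border_neighbours]
   fills the gap. *)
rewrite size_w => gE kg; have [km|mk|->] := ltngtP k m.
- rewrite inner_neighbours // (_ : k + q.+1 = m.+1 + (k + g)) -?border_eq //; lia.
- rewrite (_ : k = m.+1 + (k - m.+1)) -?border_eq; try lia.
  rewrite inner_neighbours; last lia.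
  by congr (nth _ _ _ == _); lia.
- by rewrite border_neighbours; congr (nth _ _ _ == _); lia.
Qed.

(** A run of [g] wild-cards meets every residue class modulo [g], so the period [g] spreads it over
    [w] in both directions. *)
Lemma wildcard_window g i : 0 < g -> g + m.+1 = q.+1 -> i <= m ->
  (forall t, t < g -> ch (i + t) = None) -> forall k, k < size w -> ch k = None.
Proof.
move=> g0 gE im wi; have wild k : i <= k -> k < size w -> ch k = None.
  elim/ltn_ind: k => k IH ik kw; have [kg|gk] := ltnP k (i + g).
    by rewrite -(subnKC ik) wi //; lia.
  have kE : k - g + g = k by lia.
  by apply/eqP; rewrite -kE -wildcard_period ?kE // IH //; lia.
suff wild_below d k : d + k = i -> ch k = None.
  move=> k kw; have [ki|ik] := ltnP k i; last exact: wild.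
  by apply: (wild_below (i - k)); lia.
elim/ltn_ind: d k => d IH k dk; apply/eqP; rewrite (wildcard_period gE); last lia.
have [ik|ki] := leqP i (k + g); first by rewrite wild //; lia.
by rewrite (IH (d - g)) //; lia.
Qed.

Lemma wildcards_trivial : (forall k, k < size w -> ch k = None) ->
  w = nseq q.+1 None.
Proof.
move=> wild; have /card_gt0P[d _] : 0 < #|A| by lia.
have cov i : i <= m -> matches w q.+1 i (fun=> d).
  (* Positions [0] and [m] thus both cover the constant word [d], and uniqueness gives [m = 0]. *)
  by move=> im; apply/matchesP => j jq; rewrite wild // size_w; lia.
have m0 : 0 = m := matches_unique (leq0n m) (cov 0 (leq0n m)) (leqnn m) (cov m (leqnn m)).
have sw : size w = q.+1 by rewrite size_w -m0.
apply: (@eq_from_nth _ None); first by rewrite size_nseq.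
by move=> k kw; rewrite wild // nth_nseq if_same.
Qed.

Lemma no_overlap : w <> nseq q.+1 None -> q <= m.
Proof.
move=> nt; rewrite leqNgt; apply/negP => mq; apply: nt.
apply: wildcards_trivial.
have /card_gt1P[a [b [_ _ ab]]] : 1 < #|A| by lia.
(* Constant blocks of length [m.+1] alternate, so [x t] and [x (t + m.+1)] always differ. *)
pose x j := if odd (j %/ m.+1) then a else b.
have [i im /matchesP xi] := matches_exists x.
apply: (@wildcard_window (q - m) i); try lia.
(* A letter here would recur at distance [m.+1] by [border_eq], still inside the window because
   [t < q - m]. *)
move=> t tg; case E : (ch (i + t)) => [c|] //.
have := xi t; rewrite E => /(_ ltac:(lia)) /= /eqP xt.
have := xi (t + m.+1); rewrite (_ : i + _ = m.+1 + (i + t)); last lia.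
rewrite -border_eq ?E; last lia.
move=> /(_ ltac:(lia)) /= /eqP; rewrite -xt /x divnDr // divnn /= oddD /=.
by case: odd => /= H; move: ab; rewrite H eqxx.
Qed.

End Universal.

Theorem theorem4p8 (A : finType) (n : nat) (w : pword A)
    (hA : 3 <= #|A|) (hn : 0 < n)
    (hw : universal_pword n w) (hnt : ~ trivial_pword n w) :
  cyclic_pword n w.
Proof.
case: n hn hw hnt => // q _ hw hnt.
have /card_gt0P[d _] : 0 < #|A| by lia.
(* Some position covers a word, so [q.+1 <= size w] and the subtraction below is not truncated. *)
have [i [[iw _] _]] := hw [tuple d | j < q.+1].
have sw : size w = size w - q.+1 + q.+1 by lia.
have qm : q <= size w - q.+1.
  by apply: no_overlap hA hw sw _ => E; apply: hnt; left.
rewrite /cyclic_pword subn1 /=; split; first lia.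
have stake : size (take q w) = q by rewrite size_takel //; lia.
apply: (@eq_from_nth _ None) => [|j]; rewrite stake; first by rewrite size_drop; lia.
move=> jq.
rewrite nth_take // nth_drop (border_eq hA hw sw jq).
by congr nth; lia.
Qed.
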